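(* Let $\tau>0$, $a>4$, and let $s,d$ be integers with $1\le s<d/2$. The estimator $\hat\sigma^2=\frac1d\sum_{k=1}^{d-s}Y^2_{(k)}$ satisfies $$\sup_{P_\xi\in\mathcal P_{a,\tau}}\sup_{\sigma>0}\sup_{\theta\in\Theta_s}\frac{\mathbf E_{\theta,P_\xi,\sigma}(\hat\sigma^2-\sigma^2)^2}{\sigma^4}\le C\max\Big(\frac1{\sqrt d},\Big(\frac sd\Big)^{1-\frac2a}\Big)^2,$$ where $C>0$ depends only on $a$ and $\tau$.
   Context: Model: $Y_i=\theta_i+\sigma\xi_i$, $i=1,\dots,d$, $\theta\in\mathbb R^d$, $\sigma>0$, $\xi_i$ i.i.d. with distribution $P_\xi$, $\mathbf E\xi_1=0,\mathbf E\xi_1^2=1$; $\mathbf E_{\theta,P_\xi,\sigma}$ expectation; $\Theta_s=\{\theta:\|\theta\|_0\le s\}$. For $\tau>0,a\ge2$, $\mathcal P_{a,\tau}$: distributions with $\mathbf E\xi_1=0,\mathbf E\xi_1^2=1$, $\mathbf P(|\xi_1|>t)\le(\tau/t)^a$ for all $t\ge2$. $Y^2_{(1)}\le\dots\le Y^2_{(d)}$ are the ordered values of $Y_1^2,\dots,Y_d^2$. *)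

(* Defs.v *)
From HB Require Import structures.
From mathcomp Require Import all_boot all_order all_algebra.
From mathcomp Require Import all_classical all_reals all_analysis.
Set Implicit Arguments. Unset Strict Implicit. Unset Printing Implicit Defensive.
Import Order.TTheory GRing.Theory Num.Theory.
Local Open Scope classical_set_scope.
Local Open Scope ring_scope.

(* Mutual independence of a finite family of real random variables:
   the product rule for every choice of Borel sets (take B i = setT to
   ignore index i, so this covers all finite subfamilies). *)
Definition mutually_independent {dT : measure_display} {T : measurableType dT}
  {R : realType} (P : probability T R) (n : nat) (X : 'I_n -> T -> R) : Prop :=
  forall B : 'I_n -> set R, (forall i, measurable (B i)) ->
    P (\bigcap_(i in [set: 'I_n]) (X i @^-1` B i)) =
    (\prod_(i < n) P (X i @^-1` B i))%E.

Definition identically_distributed {dT : measure_display} {T : measurableType dT}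
  {R : realType} (P : probability T R) (n : nat) (X : 'I_n -> T -> R) : Prop :=
  forall i j (B : set R), measurable B -> P (X i @^-1` B) = P (X j @^-1` B).

Definition l0norm {R : realType} (n : nat) (theta : 'I_n -> R) : nat :=
  #|[set i : 'I_n | theta i != 0%R]|%N.

Definition sigma2_hat {R : realType} (d s : nat) (Y : 'I_d -> R) : R :=
  let v := sort <=%R [seq (Y i) ^+ 2 | i <- enum 'I_d] in
  (d%:R)^-1 * \sum_(k < d - s) nth 0%R v k.

(* Main.v *)
(* Write N for the support of theta. Comparing the d - s smallest Y_i^2 with the
   Y_i^2 over the complement of N gives d * sigma_hat^2 <= sigma^2 S with
   S = sum_i xi_i^2. Conversely the chosen indices outside N miss at most 2s of
   the terms of S, and for any threshold v a sum of 2s terms xi_i^2 is at most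
   2s v^2 + W, where W = sum_i xi_i^2 1(|xi_i| > v). Hence the error is controlled
   by (S - d)^2, s^2 v^4 and W^2. Independence bounds E (S - d)^2 by d E xi^4 and
   E W^2 by d E[xi^4 1(|xi| > v)] + (d E[xi^2 1(|xi| > v)])^2, and the choice
   v = 2 (d/s)^(1/a) balances s v^2 with these truncated moments. *)
Require Import Defs.
From HB Require Import structures.
From mathcomp Require Import all_boot all_order all_algebra.
From mathcomp Require Import all_classical all_reals all_analysis.
From mathcomp Require Import measurable_realfun zify lra ring.
Import Order.TTheory GRing.Theory Num.Theory.
Local Open Scope classical_set_scope.
Local Open Scope ring_scope.

(** * Independence and products of expectations *)

(** The law of [(X, Y)] agrees with the product of the marginal laws on rectangles, hence everywhere
    by uniqueness of the product measure. Tonelli then separates the factors; nonnegativity spares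
    any integrability condition. *)
Lemma ge0_expectation_mul {dT : measure_display} {T : measurableType dT}
    {R : realType} (P : probability T R) (X Y : T -> R) (f g : R -> R) :
  measurable_fun setT X -> measurable_fun setT Y ->
  (forall A B, measurable A -> measurable B ->
    P (X @^-1` A `&` Y @^-1` B) = (P (X @^-1` A) * P (Y @^-1` B))%E) ->
  measurable_fun setT f -> measurable_fun setT g ->
  (forall x, 0 <= f x) -> (forall x, 0 <= g x) ->
  (\int[P]_w (f (X w) * g (Y w))%:E =
   (\int[P]_w (f (X w))%:E) * (\int[P]_w (g (Y w))%:E))%E.
Proof.
move=> mX mY XY mf mg f0 g0.
pose X' : {mfun T >-> R} := HB.pack X (isMeasurableFun.Build _ _ _ _ X mX).
pose Y' : {mfun T >-> R} := HB.pack Y (isMeasurableFun.Build _ _ _ _ Y mY).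
have mXY : measurable_fun setT (fun w => (X w, Y w)) by exact: measurable_fun_pair.
pose Z : {mfun T >-> (R * R)%type} :=
  HB.pack (fun w => (X w, Y w)) (isMeasurableFun.Build _ _ _ _ _ mXY).
pose h (z : R * R) := (f z.1 * g z.2)%:E.
have mh : measurable_fun [set: R * R] h.
  apply/measurable_EFinP; apply: measurable_funM.
    by apply: measurableT_comp => //; exact: measurable_fst.
  by apply: measurableT_comp => //; exact: measurable_snd.
have h0 z : (0 <= h z)%E by rewrite lee_fin mulr_ge0.
transitivity (\int[distribution P Z]_z h z)%E.
  by rewrite ge0_integral_distribution.
rewrite (eq_measure_integral (distribution P X' \x distribution P Y')%E); last first.
  move=> A mA _; symmetry.
  apply: (product_measure_unique _ mA) => A1 B1 mA1 mB1.
  by rewrite -XY.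
rewrite fubini_tonelli1//.
transitivity (\int[distribution P X']_x ((\int[P]_w (g (Y w))%:E) * (f x)%:E))%E.
  apply: eq_integral => x _; rewrite /fubini_F /h /= muleC.
  under eq_integral do rewrite EFinM.
  rewrite ge0_integralZl//; last 3 first.
  - by apply/measurable_EFinP.
  - by move=> y _; rewrite lee_fin.
  - by rewrite lee_fin.
  congr (_ * _)%E.
  rewrite (ge0_integral_distribution Y')//; exact/measurable_EFinP.
rewrite ge0_integralZl//; last 3 first.
- by apply/measurable_EFinP.
- by move=> y _; rewrite lee_fin.
- by apply: integral_ge0 => w _; rewrite lee_fin.
rewrite muleC; congr (_ * _)%E.
rewrite (ge0_integral_distribution X')//; exact/measurable_EFinP.
Qed.

Lemma mutually_independent_pair {dT : measure_display} {T : measurableType dT}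
    {R : realType} (P : probability T R) (n : nat) (X : 'I_n -> T -> R) i j :
  mutually_independent P X -> i != j ->
  forall A B, measurable A -> measurable B ->
    P (X i @^-1` A `&` X j @^-1` B) = (P (X i @^-1` A) * P (X j @^-1` B))%E.
Proof.
move=> iX ij A B mA mB.
have ji : j != i by rewrite eq_sym.
(* Filling the other coordinates with [setT] turns their factors into 1. *)
pose C k := if k == i then A else if k == j then B else setT.
have := iX C; rewrite (bigD1 i)//= (bigD1 j)//= big1 => [|k /andP[ki kj]].
  rewrite mule1 /C eqxx (negbTE ji) eqxx => <-.
    congr (P _); apply/seteqP; split => w.
      move=> [wA wB] k _ /=; case: eqVneq => [->//|_].
      by case: eqVneq => [->//|_].
    move=> Cw; split; first by have := Cw i I; rewrite /= eqxx.
    by have := Cw j I; rewrite /= (negbTE ji) eqxx.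
  by move=> k; case: ifP => // _; case: ifP.
by rewrite /C (negbTE ki) (negbTE kj) preimage_setT probability_setT.
Qed.

(** * Truncated fourth moment from the tail bound *)

(** A nonnegative integral is a supremum over simple functions lying below, and a larger function
    has more of them below it. This lets the error of the sorted estimator be bounded with no
    measurability proof for it. *)
Lemma ge0_le_integralT {d : measure_display} {T : measurableType d}
    {R : realType} (mu : {measure set T -> \bar R}) (f g : T -> \bar R) :
  (forall x, 0 <= f x)%E -> (forall x, f x <= g x)%E ->
  (\int[mu]_x f x <= \int[mu]_x g x)%E.
Proof.
move=> f0 fg; rewrite !ge0_integralTE//; last by move=> x; exact: le_trans (fg x).
by apply: ereal_sup_le => _ [h hf <-]; exists h => // x; exact: le_trans (fg x).
Qed.

Lemma ex_dyadic {R : realType} (v x : R) : 0 < v -> v < x ->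
  exists k, 2 ^+ k * v < x <= 2 ^+ k.+1 * v.
Proof.
move=> v0 vx.
have ex : exists k, x <= 2 ^+ k * v.
  (* This exponent [n] exceeds [x / v], and [n < 2 ^ n]. *)
  exists (Num.truncn (x / v)).+1; rewrite -ler_pdivrMr//.
  apply: (le_trans (ltW (truncnS_gt _))).
  by rewrite -natrX ler_nat ltnW// ltn_expl.
case: (ex_minnP ex) => -[|k]; first by rewrite mul1r leNgt vx.
move=> xk kmin; exists k; rewrite xk andbT ltNge.
by apply/negP => /kmin; rewrite ltnn.
Qed.

Lemma measurable_norm_gt {R : realType} (v : R) : measurable [set y : R | v < `|y|].
Proof.
rewrite [X in measurable X](_ : _ = @Num.norm _ R @^-1` `]v, +oo[).
  by rewrite -[X in measurable X]setTI; exact: normr_measurable.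
by apply/seteqP; split=> y /=; rewrite in_itv/= andbT.
Qed.

(** Here [4 < a] becomes convergence: the dyadic series below has ratio 16 / 2^a. *)
Lemma powR2_gt16 {R : realType} (a : R) : 4 < a -> 16 < (2 : R) `^ a.
Proof.
move=> a4; have -> : (16 : R) = 2 `^ 4%:R by rewrite powR_mulrn//; ring.
by rewrite /powR (_ : (2 : R) == 0 = false) ?pnatr_eq0// ltr_expR ltr_pM2r// ln_gt0//; lra.
Qed.

(** Cut [|X| > v] into dyadic shells. From one shell to the next the fourth power grows by 16 while
    the tail bound shrinks by 2^a, so the shells contribute at most a geometric series. *)
Lemma truncated_fourth_moment {dT : measure_display} {T : measurableType dT}
    {R : realType} (P : probability T R) (X : T -> R) (tau a v : R) :
  measurable_fun setT X -> 0 < tau -> 4 < a -> 2 <= v ->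
  (forall t : R, 2 <= t ->
     (P [set x | (t < `|X x|)%R] <= ((tau / t) `^ a)%:E)%E) ->
  (\int[P]_x (X x ^+ 4 * \1_[set y : R | v < `|y|] (X x))%:E <=
   (16 * v ^+ 4 * (tau / v) `^ a / (1 - 16 / 2 `^ a))%:E)%E.
Proof.
move=> mX tau0 a4 v2 tail.
have v0 : 0 < v by lra.
(* Full tails replace the shells so that [tail] applies to each directly; the overlaps only enlarge
   the upper bound. *)
pose A k := [set x | 2 ^+ k * v < `|X x|].
have mA k : measurable (A k).
  rewrite -[X in measurable X]setTI; exact: mX (measurable_norm_gt _).
pose b k : R := (2 ^+ k.+1 * v) ^+ 4.
have b0 k : 0 <= b k by rewrite exprn_ge0// mulr_ge0 ?exprn_ge0 ?ltW.
pose p := (2 : R) `^ a.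
have p16 : 16 < p by exact: powR2_gt16.
have p0 : 0 < p by lra.
(* On 2^k v < |X| <= 2^(k+1) v the k-th term alone dominates X^4. *)
pose f k x := (b k * \1_(A k) x)%:E.
have mf k : measurable_fun setT (f k).
  apply/measurable_EFinP; apply: measurable_funM => //.
have f0 k x : (0 <= f k x)%E by rewrite lee_fin mulr_ge0.
have intf k : (\int[P]_x f k x <= (geometric (16 * v ^+ 4 * (tau / v) `^ a) (16 / p) k)%:E)%E.
  rewrite /f; under eq_integral do rewrite EFinM.
  rewrite ge0_integralZl//=; last 2 first.
  - exact/measurable_EFinP.
  - by rewrite lee_fin.
 rewrite integral_indic// setIT.
  have v2k : 2 <= 2 ^+ k * v.
    by apply: (le_trans v2); apply: ler_peMl; [lra|apply: exprn_ege1; lra].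
  apply: (le_trans (lee_wpmul2l _ (tail _ v2k))); first by rewrite lee_fin.
  rewrite -EFinM lee_fin le_eqVlt; apply/orP; left; apply/eqP.
  have -> : tau / (2 ^+ k * v) = (tau / v) * (2 ^+ k)^-1 by rewrite invfM; ring.
  rewrite powRM ?divr_ge0 ?invr_ge0 ?exprn_ge0 ?(ltW v0) ?(ltW tau0)//.
  have -> : ((2 : R) ^+ k)^-1 `^ a = p ^- k.
    rewrite -powR_inv1 ?exprn_ge0// -powR_mulrn// -!powRrM -powR_mulrn ?(ltW p0)//.
    by rewrite -powRrM -powRN; congr (_ `^ _); ring.
  rewrite /b /= exprMn exprAC exprS (_ : 2 ^+ 4 = 16); last by ring.
  by rewrite expr_div_n; ring.
apply: (@le_trans _ _ (\int[P]_x (\sum_(0 <= k <oo) f k x))%E).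
  apply: ge0_le_integralT => x.
    by rewrite lee_fin mulr_ge0// exprn_even_ge0.
  rewrite indicE; case: (boolP (_ \in _)) => [|_]; last first.
    by rewrite mulr0 nneseries_ge0.
  rewrite inE/= => vx; rewrite mulr1.
  have [k /andP[kx xk]] := ex_dyadic _ _ v0 vx.
  (* The partial sum of length [k.+1] has the k-th term as its last one. *)
  apply: le_trans (nneseries_lim_ge k.+1 _); last by move=> *; exact: f0.
  rewrite big_nat_recr//= -[leLHS]add0e; apply: leeD.
    by apply: sume_ge0 => i _; exact: f0.
  rewrite lee_fin indicE mem_set// mulr1 /b.
  rewrite -(ger0_norm (exprn_even_ge0 (n := 4) (X x) isT)) normrX.
  by rewrite lerXn2r// nnegrE ?normr_ge0// (le_trans _ xk).
rewrite integral_nneseries//.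
apply: lime_le.
  by apply: is_cvg_nneseries => k _ _; apply: integral_ge0 => x _; exact: f0.
apply: nearW => n.
apply: (le_trans (lee_sum _ (fun k _ => intf k))).
rewrite sumEFin lee_fin; apply: geometric_le_lim.
- by rewrite mulr_ge0 ?powR_ge0// mulr_ge0// exprn_ge0// ltW.
- by rewrite divr_gt0.
- by rewrite ger0_norm ?divr_ge0 ?ltW// ltr_pdivrMr// mul1r.
Qed.

(** * Order statistics and the deterministic error bound *)

(** A level [c >= 0] separates the values on [A] from those off [A]. Then [A] collects every
    negative [f i - c] and no positive one, so it minimises the sum of [f i - c]; restoring [c]
    costs at most [c] times [#|A| - #|B|], which is not positive. *)
Lemma le_sum_smallest {R : realDomainType} {I : finType} (f : I -> R) (A B : {set I}) :
  (forall i, 0 <= f i) -> (forall i j, i \in A -> j \notin A -> f i <= f j) ->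
  (#|A| <= #|B|)%N -> \sum_(i in A) f i <= \sum_(i in B) f i.
Proof.
move=> f0 fA AB.
have [c c0 [cA cB]] : exists2 c, 0 <= c &
    (forall i, i \in A -> f i <= c) /\ (forall i, i \notin A -> c <= f i).
  (* The level is the minimum of [f] off [A], or the total sum when [A] is everything. *)
  have [[j jA]|noj] := pselect (exists j, j \notin A).
    have [m mA mmin] := @arg_minP _ _ _ j [pred i | i \notin A] f jA.
    by exists (f m) => //; split=> [i iA|i iA]; [exact: fA|exact: mmin].
  exists (\sum_i f i); first exact: sumr_ge0.
  split=> [i _|i iA]; last by exfalso; apply: noj; exists i.
  by rewrite (bigD1 i)//= lerDl sumr_ge0.
have key i : (f i - c) * (i \in A)%:R <= (f i - c) * (i \in B)%:R.
  case: (boolP (i \in A)) => [/cA|/cB] fc; case: (i \in B); rewrite ?mulr1 ?mulr0//.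
  - by rewrite subr_le0.
  - by rewrite subr_ge0.
have sumE (D : {set I}) : \sum_i (f i - c) * (i \in D)%:R = \sum_(i in D) f i - c *+ #|D|.
  rewrite -sumr_const -sumrB [RHS]big_mkcond/=; apply: eq_bigr => i _.
  by case: (i \in D); rewrite ?mulr1 ?mulr0.
have := ler_sum (index_enum I) (P := xpredT) (fun i _ => key i).
rewrite !sumE lerBlDr => /le_trans -> //.
by rewrite -addrA gerDl addrC subr_le0 ler_wpMn2l.
Qed.

(** Sorting the indices by [f] instead of sorting the values makes a prefix of the sorted list a set
    of indices, ties included. *)
Lemma sum_sorted_prefix {R : realDomainType} (d m : nat) (f : 'I_d -> R) : (m <= d)%N ->
  exists A : {set 'I_d}, [/\ #|A| = m,
    forall i j, i \in A -> j \notin A -> f i <= f j &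
    \sum_(k < m) nth 0 (sort <=%R [seq f i | i <- enum 'I_d]) k = \sum_(i in A) f i].
Proof.
move=> md; rewrite sort_map.
set e := sort _ _.
have pe : perm_eq e (enum 'I_d) by rewrite perm_sort.
have ue : uniq e by rewrite (perm_uniq pe) enum_uniq.
have se : size e = d by rewrite (perm_size pe) size_enum_ord.
have sm : size (take m e) = m by rewrite size_take_min se (minn_idPl md).
have um : uniq (take m e) by rewrite take_uniq.
have ine i : i \in e by rewrite (perm_mem pe) mem_enum.
have srt : sorted (relpre f <=%R) e by apply: sort_sorted => x y; exact: le_total.
exists [set i in take m e]; split.
- by rewrite cardsE (card_uniqP um).
- move=> i j; rewrite !inE => iA jA.
  have jD : j \in drop m e.
    move: (ine j); rewrite -[in X in X -> _](cat_take_drop m e) mem_cat.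
    by rewrite (negbTE jA).
  have tr : transitive (relpre f <=%R) by move=> y x z; exact: le_trans.
  move: srt; rewrite -{1}(cat_take_drop m e) sorted_pairwise// pairwise_cat.
  by move=> /andP[/allrelP/(_ _ _ iA jD)].
- transitivity (\sum_(i <- take m e) f i); last first.
    by rewrite big_uniq//=; apply: eq_bigl => i; rewrite inE.
  rewrite -(big_map f xpredT id) map_take (big_nth 0) size_take_min size_map se.
  rewrite (minn_idPl md) big_mkord; apply: eq_bigr => k _.
  by rewrite nth_take.
Qed.

(** This is a pathwise bound. The error times [d / sigma ^+ 2] lies between [u - t] and [u], where
    [u] is the centred sum of squares and [t] bounds the terms lost. *)
Lemma sigma2_hat_sqr_error {R : realType} (d s : nat) (theta xi : 'I_d -> R) (sigma v : R) :
  (2 * s < d)%N -> 0 < sigma -> 0 <= v -> (l0norm theta <= s)%N ->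
  (sigma2_hat s (fun i => theta i + sigma * xi i) - sigma ^+ 2) ^+ 2 <=
  sigma ^+ 4 / d%:R ^+ 2 *
    (2 * (\sum_i xi i ^+ 2 - d%:R) ^+ 2 + 16 * s%:R ^+ 2 * v ^+ 4 +
     4 * (\sum_i xi i ^+ 2 * \1_[set y : R | v < `|y|] (xi i)) ^+ 2).
Proof.
move=> sd sg0 v0 ths.
have d0 : 0 < d%:R :> R by rewrite ltr0n; case: d sd {theta xi ths}.
pose N := [set i : 'I_d | theta i != 0]%SET.
have cN : (#|N| <= s)%N.
  apply: leq_trans ths; rewrite /l0norm; apply: eq_leq; apply: eq_card => i.
  by rewrite !inE; apply/idP/idP; rewrite in_setE.
pose f i := (theta i + sigma * xi i) ^+ 2.
have f0 i : 0 <= f i by exact: sqr_ge0.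
have fN i : i \notin N -> f i = sigma ^+ 2 * xi i ^+ 2.
  by rewrite inE negbK /f => /eqP->; rewrite add0r exprMn.
have [A [cA fA sumA]] := @sum_sorted_prefix R d (d - s) f (leq_subr s d).
rewrite /sigma2_hat sumA.
set Q := \sum_(i in A) f i.
set S := \sum_i xi i ^+ 2.
set ind := \1_[set y : R | v < `|y|].
set W := \sum_i xi i ^+ 2 * ind (xi i).
have s0 : (0 : R) <= sigma ^+ 2 by exact: sqr_ge0.
(* At least [d - s] coordinates carry pure noise, so their complete sum dominates the [d - s]
   smallest squares. *)
have cNC : (#|A| <= #|~: N|)%N by have := cardsC N; rewrite card_ord; lia.
have Q_le : Q <= sigma ^+ 2 * S.
  apply: (le_trans (le_sum_smallest _ _ _ f0 fA cNC)).
  rewrite /S mulr_sumr [leRHS](bigID (fun i => i \in ~: N))/=.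
  rewrite (eq_bigr (fun i => sigma ^+ 2 * xi i ^+ 2)); last first.
    by move=> i; rewrite inE => /fN.
  by rewrite lerDl; apply: sumr_ge0 => i _; rewrite mulr_ge0 ?sqr_ge0.
have ind0 y : 0 <= ind y by rewrite /ind indicE.
have W0 : 0 <= W by apply: sumr_ge0 => i _; rewrite mulr_ge0 ?sqr_ge0.
(* Only the at most 2s indices outside A :\: N are lost. *)
pose G := A :\: N.
have cG : (#|~: G| <= 2 * s)%N.
  have GC := cardsC G; rewrite card_ord in GC.
  have GD : #|G| = (#|A| - #|A :&: N|)%N by rewrite cardsD.
  have AN : (#|A :&: N| <= #|N|)%N by rewrite subset_leq_card// subsetIr.
  move: GC GD AN cA cN; clear -sd; lia.
have xi_le i : xi i ^+ 2 <= v ^+ 2 + xi i ^+ 2 * ind (xi i).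
  rewrite /ind indicE; case: (boolP (_ \in _)) => [_|].
    by rewrite mulr1 lerDr sqr_ge0.
  rewrite mulr0 addr0 notin_setE/= => /negP; rewrite -leNgt => xv.
  by rewrite -(real_normK (num_real (xi i))) lerXn2r// nnegrE.
have Q_ge : sigma ^+ 2 * S <= Q + sigma ^+ 2 * (2 * s%:R * v ^+ 2 + W).
  (* On [G] the noise terms are summands of [Q]; off [G] each is bounded by [xi_le]. *)
  rewrite {1}/S (bigID (fun i => i \in G))/= mulrDr; apply: lerD.
    rewrite mulr_sumr (eq_bigr f); last first.
      by move=> i; rewrite inE => /andP[/fN ->].
    rewrite /Q [leRHS](bigID (fun i => i \in G))/=.
    rewrite (eq_bigl (fun i => (i \in A) && (i \in G))); last first.
      by move=> i; rewrite !inE; case: (i \in A); rewrite ?andbT ?andbF.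
    by rewrite lerDl sumr_ge0.
  rewrite ler_wpM2l//.
  apply: (le_trans (ler_sum _ (fun i _ => xi_le i))).
  rewrite big_split/=; apply: lerD.
    rewrite (eq_bigl (fun i => i \in ~: G)); last by move=> i; rewrite finset.in_setC.
    rewrite sumr_const -[v ^+ 2 *+ _]mulr_natl ler_wpM2r ?sqr_ge0//.
    by rewrite -natrM ler_nat (leq_trans _ cG)// eq_leq//; exact: eq_card.
  rewrite /W [leRHS](bigID (fun i => i \in G))/= lerDr sumr_ge0// => i _.
  by rewrite mulr_ge0 ?sqr_ge0.
have sg2 : 0 < sigma ^+ 2 by rewrite exprn_gt0.
pose y := Q / sigma ^+ 2 - d%:R.
pose t := 2 * s%:R * v ^+ 2 + W.
have t0 : 0 <= t by rewrite addr_ge0// !mulr_ge0// sqr_ge0.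
have yu : y <= S - d%:R by rewrite /y lerD2r ler_pdivrMr// mulrC.
have yl : S - d%:R - t <= y.
  rewrite /y addrAC lerD2r lerBlDr -(ler_pM2l sg2) mulrDr.
  by rewrite [_ * (Q / _)]mulrC divfK ?gt_eqF.
have -> : d%:R^-1 * Q - sigma ^+ 2 = sigma ^+ 2 / d%:R * y.
  by rewrite /y; field; rewrite !gt_eqF.
rewrite exprMn [(_ / _) ^+ 2]expr_div_n -exprM ler_wpM2l//.
  by rewrite divr_ge0// exprn_ge0// ltW.
(* If [y >= 0] then [y ^+ 2 <= u ^+ 2]; otherwise [y ^+ 2 <= (u - t) ^+ 2], and adding
   [(u + t) ^+ 2] gives the right side. *)
have y2 : y ^+ 2 <= 2 * (S - d%:R) ^+ 2 + 2 * t ^+ 2.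
  move: yu yl; move: (S - d%:R) => u yu yl.
  have [y0|y0] := lerP 0 y.
    have : 0 <= (u - y) * (u + y) by rewrite mulr_ge0; lra.
    have := sqr_ge0 t; have := sqr_ge0 u; nra.
  have : 0 <= (y - (u - t)) * (- (u - t) - y) by rewrite mulr_ge0; lra.
  have := sqr_ge0 (u + t); nra.
apply: (le_trans y2); rewrite -addrA lerD2l /t.
have := sqr_ge0 (2 * s%:R * v ^+ 2 - W); nra.
Qed.

(** * Second moment of a sum of independent terms *)

(** Expand the square: diagonal terms are bounded by [m2], and off the diagonal independence factors
    the expectation. Allowing [m1 ^+ 2] on the diagonal too gives one formula for all pairs, whence
    the full [n ^ 2]. *)
Lemma expectation_sqr_sum_le {dT : measure_display} {T : measurableType dT}
    {R : realType} (P : probability T R) (n : nat) (X : 'I_n -> T -> R)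
    (h : R -> R) (m1 m2 : R) :
  (forall i, measurable_fun setT (X i)) -> mutually_independent P X ->
  measurable_fun setT h -> (forall x, 0 <= h x) -> 0 <= m1 -> 0 <= m2 ->
  (forall i, \int[P]_w (h (X i w))%:E <= m1%:E)%E ->
  (forall i, \int[P]_w (h (X i w) ^+ 2)%:E <= m2%:E)%E ->
  (\int[P]_w ((\sum_i h (X i w)) ^+ 2)%:E <= (n%:R * m2 + n%:R ^+ 2 * m1 ^+ 2)%:E)%E.
Proof.
move=> mX iX mh h0 m10 m20 hm1 hm2.
have mhX i : measurable_fun setT (fun w => h (X i w)) by exact: measurableT_comp.
have mhh i j : measurable_fun setT (fun w => (h (X i w) * h (X j w))%:E).
  by apply/measurable_EFinP; apply: measurable_funM.
have hh0 i j w : (0 <= (h (X i w) * h (X j w))%:E)%E by rewrite lee_fin mulr_ge0.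
have -> : (\int[P]_w ((\sum_i h (X i w)) ^+ 2)%:E =
    \sum_i \sum_j \int[P]_w (h (X i w) * h (X j w))%:E)%E.
  under eq_integral => w _.
    rewrite expr2 mulr_suml -sumEFin.
    under eq_bigr do rewrite mulr_sumr -sumEFin.
    over.
  rewrite ge0_integral_sum//; last 2 first.
  - by move=> i; exact: emeasurable_sum.
  - by move=> i w _; exact: sume_ge0.
  by apply: eq_bigr => i _; rewrite ge0_integral_sum.
have le_ij i j : (\int[P]_w (h (X i w) * h (X j w))%:E <=
    (m2 * (i == j)%:R + m1 ^+ 2)%:E)%E.
  have [->|ij] := eqVneq i j.
    by apply: (le_trans (hm2 j)); rewrite lee_fin mulr1 lerDl sqr_ge0.
  rewrite (ge0_expectation_mul P _ _ _ _ (mX i) (mX j)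
    (mutually_independent_pair P _ _ _ _ iX ij))//.
  rewrite mulr0 add0r expr2 EFinM; apply: lee_pmul => //.
    by apply: integral_ge0 => w _; rewrite lee_fin.
  by apply: integral_ge0 => w _; rewrite lee_fin.
apply: (@le_trans _ _ (\sum_(i < n) \sum_(j < n) (m2 * (i == j)%:R + m1 ^+ 2)%:E)%E).
  by apply: lee_sum => i _; apply: lee_sum => j _; exact: le_ij.
under eq_bigr do rewrite sumEFin.
rewrite sumEFin lee_fin.
under eq_bigr => i _.
  rewrite big_split/= -mulr_sumr (bigD1 i)//= eqxx big1; last first.
    by move=> j; rewrite eq_sym => /negbTE ->.
  rewrite sumr_const card_ord addr0 mulr1.
  over.
rewrite sumr_const card_ord -[leLHS]mulr_natl -[m1 ^+ 2 *+ n]mulr_natl.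
by rewrite le_eqVlt; apply/orP; left; apply/eqP; ring.
Qed.

(** * Choice of the constants, moment bounds and the final risk bound *)

Theorem theorem4 (R : realType) (tau a : R) (htau : 0 < tau) (ha : 4 < a) :
  exists C : R, 0 < C /\
  forall (s d : nat), (1 <= s)%N -> (2 * s < d)%N ->
  forall (dT : measure_display) (T : measurableType dT) (P : probability T R)
         (xi : 'I_d -> T -> R),
    (forall i, measurable_fun setT (xi i)) ->
    mutually_independent P xi ->
    identically_distributed P xi ->
    (forall i, (\int[P]_x (xi i x)%:E = 0)%E) ->
    (forall i, (\int[P]_x ((xi i x) ^+ 2)%:E = 1)%E) ->
    (forall i (t : R), 2 <= t ->
       (P [set x | (t < `|xi i x|)%R] <= ((tau / t) `^ a)%:E)%E) ->
  forall (sigma : R), 0 < sigma ->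
  forall (theta : 'I_d -> R), (l0norm theta <= s)%N ->
    (\int[P]_x ((sigma2_hat s (fun i => theta i + sigma * xi i x)
                  - sigma ^+ 2) ^+ 2)%:E
     <= (C * (Num.max (Num.sqrt (d%:R))^-1
                      ((s%:R / d%:R) `^ (1 - 2 / a))) ^+ 2
           * sigma ^+ 4)%:E)%E.
Proof.
have a0 : 0 < a by lra.
(* Truncating at 2 bounds the fourth moment above 2 by [16 * B]; below 2 it is at most 16, whence
   [m4]. *)
pose B := 16 * (tau / 2) `^ a / (1 - 16 / 2 `^ a).
have B0 : 0 <= B.
  rewrite divr_ge0 ?mulr_ge0 ?powR_ge0// subr_ge0 ler_pdivrMr ?powR_gt0// mul1r.
  exact: ltW (powR2_gt16 _ ha).
pose m4 := 16 + 16 * B.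
have m40 : 0 <= m4 by rewrite /m4; lra.
(* The part [2 * m4] multiplies 1/d. In the bracket, 16 comes from the threshold term and the [B]
   terms from [W]; the outer 16 is the square of the 4 in [v2rho]. *)
exists (2 * m4 + 16 * (16 + 4 * B + 4 * B ^+ 2)); split.
  by have := sqr_ge0 B; rewrite /m4; lra.
move=> s d s1 sd dT T P xi mxi ixi _ _ exi2 tail sigma sg0 theta ths.
have s1R : 1 <= s%:R :> R by rewrite ler1n.
have d0 : 0 < d%:R :> R by rewrite ltr0n; lia.
pose rho : R := s%:R / d%:R.
have rho0 : 0 < rho by rewrite divr_gt0//; lra.
have rho1 : rho <= 1 by rewrite ler_pdivrMr// mul1r ler_nat; lia.
pose v := 2 * rho `^ (- a^-1).
have rv1 : 1 <= rho `^ (- a^-1).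
  by rewrite -(powRr0 rho) ger_powR ?rho0// oppr_le0 invr_ge0 ltW.
have v2 : 2 <= v by rewrite /v; lra.
have v0 : 0 <= v by lra.
(* The exponent in [v] makes the tail bound linear in [rho], and [v ^+ 2 * rho] becomes the target
   rate. *)
have tauv : (tau / v) `^ a = (tau / 2) `^ a * rho.
  have -> : tau / v = tau / 2 * rho `^ (a^-1).
    by rewrite /v powRN invfM invrK; ring.
  rewrite powRM ?powR_ge0 ?divr_ge0 ?(ltW htau)//.
  by rewrite -powRrM mulVf ?gt_eqF// powRr1// ltW.
have v2rho : v ^+ 2 * rho = 4 * rho `^ (1 - 2 / a).
  rewrite powRD; last by rewrite (gt_eqF rho0) implybT.
  have -> : - (2 / a) = - a^-1 * 2%:R by ring.
  by rewrite powRr1 ?(ltW rho0)// /v exprMn powRrM powR_mulrn ?powR_ge0//; ring.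
have Pcst (r : R) : (\int[P]_x r%:E = r%:E)%E.
  by rewrite integral_cst// [X in (r%:E * X)%E]probability_setT mule1.
have M4 u i : 2 <= u ->
    (\int[P]_x (xi i x ^+ 4 * \1_[set y : R | u < `|y|] (xi i x))%:E <=
     (16 * u ^+ 4 * (tau / u) `^ a / (1 - 16 / 2 `^ a))%:E)%E.
  by move=> u2; apply: truncated_fourth_moment => //; exact: tail.
have mpow k : measurable_fun [set: R] (fun x : R => x ^+ k).
  exact: exprn_measurable.
have mind u : measurable_fun [set: R] (\1_[set y : R | u < `|y|] : R -> R).
  exact: measurable_indic (measurable_norm_gt u).
pose h (x : R) := x ^+ 2.
pose g (x : R) := x ^+ 2 * \1_[set y : R | v < `|y|] x.
have mh : measurable_fun setT h by exact: mpow.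
have mg : measurable_fun setT g by exact: measurable_funM.
have h0 x : 0 <= h x by exact: sqr_ge0.
have ind0 u (x : R) : 0 <= (\1_[set y : R | u < `|y|] x : R) by rewrite indicE.
have g0 x : 0 <= g x by rewrite mulr_ge0// sqr_ge0.
have h2 i : (\int[P]_x (h (xi i x) ^+ 2)%:E <= m4%:E)%E.
  apply: (@le_trans _ _ (\int[P]_x (16%:E +
      (xi i x ^+ 4 * \1_[set y : R | 2 < `|y|] (xi i x))%:E))%E).
    apply: ge0_le_integralT => x; first by rewrite lee_fin sqr_ge0.
    rewrite -EFinD lee_fin /h -exprM (_ : (2 * 2)%N = 4)// indicE.
    case: (boolP (_ \in _)) => [_|]; first by rewrite mulr1 lerDr.
    rewrite notin_setE/= mulr0 addr0 => /negP; rewrite -leNgt => x2.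
    rewrite -(ger0_norm (exprn_even_ge0 (n := 4) (xi i x) isT)) normrX.
    by rewrite (_ : 16 = 2 ^+ 4); [rewrite lerXn2r// nnegrE|ring].
  rewrite ge0_integralD//; last 2 first.
  - by move=> x _; rewrite lee_fin mulr_ge0// exprn_even_ge0.
  - apply/measurable_EFinP; apply: measurable_funM.
      by apply: measurableT_comp (mpow 4%N) (mxi i).
    exact: measurableT_comp (mind 2) (mxi i).
  rewrite Pcst (_ : m4%:E = 16%:E + (16 * B)%:E)%E//.
  apply: leeD2l; apply: (le_trans (M4 _ i (lexx 2))).
  by rewrite lee_fin /B le_eqVlt; apply/orP; left; apply/eqP; ring.
have g2 i : (\int[P]_x (g (xi i x) ^+ 2)%:E <= (v ^+ 4 * rho * B)%:E)%E.
  under eq_integral => x _.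
    rewrite /g exprMn -exprM (_ : \1_ _ _ ^+ 2 = \1_[set y : R | v < `|y|] (xi i x)); last first.
      by rewrite indicE; case: (_ \in _); rewrite ?expr1n ?expr0n.
    over.
  apply: (le_trans (M4 _ i v2)); rewrite tauv /B lee_fin.
  by rewrite le_eqVlt; apply/orP; left; apply/eqP; ring.
have g1 i : (\int[P]_x (g (xi i x))%:E <= (v ^+ 2 * rho * B)%:E)%E.
  have vv : 0 < v ^+ 2 by rewrite exprn_gt0//; lra.
  have mg2 : measurable_fun setT (fun x => (g (xi i x) ^+ 2)%:E).
    apply/measurable_EFinP; apply: measurableT_comp (mpow 2%N) _.
    exact: measurableT_comp mg (mxi i).
  (* [g] is either 0 or above [v ^+ 2], so it is at most [g ^+ 2 / v ^+ 2] and the second moment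
     controls the first. *)
  apply: (@le_trans _ _ (\int[P]_x ((v ^- 2)%:E * (g (xi i x) ^+ 2)%:E))%E).
    apply: ge0_le_integralT => x; rewrite -?EFinM lee_fin//.
    rewrite mulrC ler_pdivlMr// /g indicE; case: (boolP (_ \in _)) => [|_]; last first.
      by rewrite !mulr0 mul0r expr0n.
    rewrite inE/= => vx; rewrite !mulr1 [leRHS]expr2 ler_wpM2l ?sqr_ge0//.
    by rewrite -(real_normK (num_real (xi i x))) lerXn2r ?nnegrE// ltW.
  rewrite ge0_integralZl_EFin//; last 2 first.
  - by move=> x _; rewrite lee_fin sqr_ge0.
  - by rewrite invr_ge0 ltW.
  apply: (le_trans (lee_wpmul2l _ (g2 i))); first by rewrite lee_fin invr_ge0 ltW.
  rewrite -EFinM lee_fin le_eqVlt; apply/orP; left; apply/eqP; field.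
  by rewrite gt_eqF//; lra.
pose S x := \sum_i h (xi i x).
pose W x := \sum_i g (xi i x).
have mS : measurable_fun setT S.
  by apply: measurable_sum => i; exact: measurableT_comp mh (mxi i).
have mW : measurable_fun setT W.
  by apply: measurable_sum => i; exact: measurableT_comp mg (mxi i).
have S0 x : 0 <= S x by exact: sumr_ge0.
have ES : (\int[P]_x (S x)%:E = d%:R%:E)%E.
  under eq_integral do rewrite /S -sumEFin.
  rewrite ge0_integral_sum//; last 2 first.
  - by move=> i; apply/measurable_EFinP; exact: measurableT_comp mh (mxi i).
  - by move=> i x _; rewrite lee_fin.
  by under eq_bigr do rewrite exi2; rewrite sumEFin sumr_const card_ord.
(* Taking [m1 = 1], the exact mean, makes the [d ^ 2] term cancel after centring. *)
have ES2 : (\int[P]_x (S x ^+ 2)%:E <= (d%:R * m4 + d%:R ^+ 2 * 1 ^+ 2)%:E)%E.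
  by apply: expectation_sqr_sum_le => // i; rewrite exi2.
have EW2 : (\int[P]_x (W x ^+ 2)%:E <=
    (d%:R * (v ^+ 4 * rho * B) + d%:R ^+ 2 * (v ^+ 2 * rho * B) ^+ 2)%:E)%E.
  apply: expectation_sqr_sum_le => //.
  - by rewrite mulr_ge0// mulr_ge0 ?exprn_ge0 ?(ltW rho0).
  - by rewrite mulr_ge0// mulr_ge0 ?exprn_ge0 ?(ltW rho0).
have mSd : measurable_fun setT (fun x => ((S x - d%:R) ^+ 2)%:E).
  apply/measurable_EFinP; apply: measurableT_comp (mpow 2%N) _.
  exact: measurable_funB.
have ESd : (\int[P]_x ((S x - d%:R) ^+ 2)%:E <= (d%:R * m4)%:E)%E.
  (* Integrate (S - d)^2 + 2dS = S^2 + d^2, where every term is nonnegative. *)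
  have : (\int[P]_x (((S x - d%:R) ^+ 2)%:E + (2 * d%:R)%:E * (S x)%:E) =
          \int[P]_x ((S x ^+ 2)%:E + (d%:R ^+ 2)%:E))%E.
    by apply: eq_integral => x _; rewrite -!EFinM -!EFinD; congr EFin; ring.
  rewrite ge0_integralD//; last 3 first.
  - by move=> x _; rewrite lee_fin sqr_ge0.
  - by move=> x _; rewrite -EFinM lee_fin !mulr_ge0// ltW.
  - by apply: measurable_funeM; apply/measurable_EFinP.
  rewrite [X in _ = X -> _]ge0_integralD//; last 2 first.
  - by move=> x _; rewrite lee_fin sqr_ge0.
  - by apply/measurable_EFinP; exact: measurableT_comp (mpow 2%N) mS.
  rewrite ge0_integralZl_EFin//; last 2 first.
  - by move=> x _; rewrite lee_fin.
  - exact/measurable_EFinP.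
  rewrite ES Pcst => E.
  rewrite -(@leeD2rE _ ((2 * d%:R)%:E * d%:R%:E)%E) -?EFinM// E.
  apply: (le_trans (leeD2r _ ES2)); rewrite -!EFinD lee_fin.
  by rewrite le_eqVlt; apply/orP; left; apply/eqP; ring.
pose c := sigma ^+ 4 / d%:R ^+ 2.
have c0 : 0 <= c by rewrite divr_ge0// exprn_ge0// ltW.
pose k := 16 * s%:R ^+ 2 * v ^+ 4.
have k0 : 0 <= k by apply: mulr_ge0; [apply: mulr_ge0 => //; exact: sqr_ge0|exact: exprn_ge0].
apply: (@le_trans _ _ (\int[P]_x (c%:E *
    (2%:E * ((S x - d%:R) ^+ 2)%:E + k%:E + 4%:E * (W x ^+ 2)%:E)))%E).
  apply: ge0_le_integralT => x; first by rewrite lee_fin sqr_ge0.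
  have := sigma2_hat_sqr_error d s theta (xi ^~ x) sigma v sd sg0 v0 ths.
  by rewrite -lee_fin.
have mW2 : measurable_fun setT (fun x => (W x ^+ 2)%:E).
  apply/measurable_EFinP; exact: measurableT_comp (mpow 2%N) mW.
have p1 x : (0 <= 2%:E * ((S x - d%:R) ^+ 2)%:E)%E.
  by rewrite -EFinM lee_fin mulr_ge0// sqr_ge0.
have p2 x : (0 <= 4%:E * (W x ^+ 2)%:E)%E by rewrite -EFinM lee_fin mulr_ge0// sqr_ge0.
have m1 : measurable_fun setT (fun x => 2%:E * ((S x - d%:R) ^+ 2)%:E)%E.
  by exact: measurable_funeM.
have m2 : measurable_fun setT (fun x => 4%:E * (W x ^+ 2)%:E)%E by exact: measurable_funeM.
have m3 : measurable_fun setT (fun x => 2%:E * ((S x - d%:R) ^+ 2)%:E + k%:E)%E.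
  by exact: emeasurable_funD.
rewrite ge0_integralZl_EFin//; last 2 first.
- by move=> x _; rewrite !adde_ge0.
- exact: emeasurable_funD.
rewrite ge0_integralD//; last by move=> x _; rewrite adde_ge0.
rewrite ge0_integralD//.
rewrite Pcst.
rewrite !ge0_integralZl_EFin//; last 2 first.
- by move=> x _; rewrite lee_fin sqr_ge0.
- by move=> x _; rewrite lee_fin sqr_ge0.
apply: (@le_trans _ _ (c%:E * (2%:E * (d%:R * m4)%:E + k%:E +
    4%:E * (d%:R * (v ^+ 4 * rho * B) + d%:R ^+ 2 * (v ^+ 2 * rho * B) ^+ 2)%:E))%E).
  apply: lee_wpmul2l; first by rewrite lee_fin.
  by apply: leeD; [apply: leeD => //|]; apply: lee_wpmul2l.
rewrite [leLHS](_ : _ = (c * (2 * (d%:R * m4) + k +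
  4 * (d%:R * (v ^+ 4 * rho * B) + d%:R ^+ 2 * (v ^+ 2 * rho * B) ^+ 2)))%:E)//.
rewrite lee_fin.
set r := rho `^ _ in v2rho *.
set M := Num.max _ _.
have M0 : 0 <= (Num.sqrt d%:R)^-1 :> R by rewrite invr_ge0 sqrtr_ge0.
have Md : d%:R^-1 <= M ^+ 2.
  rewrite -{1}(sqr_sqrtr (ltW d0)) -exprVn lerXn2r ?nnegrE ?le_max ?M0 ?lexx//.
have Mr : r ^+ 2 <= M ^+ 2.
  by rewrite lerXn2r ?nnegrE ?le_max ?M0 ?lexx ?powR_ge0 ?orbT.
have sE : s%:R = rho * d%:R by rewrite /rho divfK ?gt_eqF.
(* Since [d * rho = s >= 1], the diagonal part of the bound on [W ^+ 2], linear in [d * rho], is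
   absorbed into the quadratic rate. *)
have srho : d%:R * rho <= (d%:R * rho) ^+ 2.
  by rewrite mulrC -sE expr2 ler_peMl//; lra.
apply: (@le_trans _ _ (sigma ^+ 4 *
    (2 * m4 * d%:R^-1 + (16 + 4 * B + 4 * B ^+ 2) * (v ^+ 2 * rho) ^+ 2))).
  rewrite /c -mulrA ler_wpM2l ?exprn_ge0 ?(ltW sg0)// ler_pdivrMl ?exprn_gt0//.
  have -> : d%:R ^+ 2 * (2 * m4 / d%:R + (16 + 4 * B + 4 * B ^+ 2) * (v ^+ 2 * rho) ^+ 2)
     = 2 * (d%:R * m4) + k + 4 * ((d%:R * rho) ^+ 2 * (v ^+ 4 * B) + d%:R ^+ 2 * (v ^+ 2 * rho * B) ^+ 2).
    by rewrite /k sE; field; rewrite gt_eqF.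
  rewrite lerD2l ler_pM2l// lerD2r.
  rewrite [leLHS](_ : _ = d%:R * rho * (v ^+ 4 * B)); last by ring.
  by rewrite ler_wpM2r// mulr_ge0// exprn_ge0.
rewrite v2rho mulrC ler_wpM2r ?exprn_ge0 ?(ltW sg0)// [leRHS]mulrDl; apply: lerD.
  by rewrite ler_wpM2l// mulr_ge0.
rewrite [leLHS](_ : _ = 16 * (16 + 4 * B + 4 * B ^+ 2) * r ^+ 2); last by ring.
by rewrite ler_wpM2l//; have := sqr_ge0 B; lra.
Qed.
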